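(* Let $A$ and $X$ be sets and let $R \subseteq A \times X$ be a relation such that every element is related to a finite number of elements (i.e. each $a \in A$ is related to only finitely many $x \in X$, and each $x \in X$ is related to only finitely many $a \in A$). Let $D_A$ and $D_X$ be the Dowker complexes of $R$ with base $A$ and base $X$ respectively. Then the geometric realizations are homotopy equivalent: $\|D_A\| \simeq \|D_X\|$.
   Context: For a relation $R \subseteq A \times X$, write $aRx$ for $(a,x) \in R$. The Dowker complex with base $A$, $D_A$, is the abstract simplicial complex whose simplices are the non-empty finite subsets $\sigma_A \subseteq A$ for which there is some $x \in X$ with $\sigma_A \times \{x\} \subseteq R$. Symmetrically, $D_X$ has as simplices the non-empty finite subsets $\sigma_X \subseteq X$ for which there is some $a \in A$ with $\{a\} \times \sigma_X \subseteq R$. $\|K\|$ denotes the geometric realization of a simplicial complex $K$. *)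

(* Defs.v *)
From HB Require Import structures.
From mathcomp Require Import all_boot all_order all_algebra finmap.
From mathcomp Require Import all_classical all_reals all_analysis.

Set Implicit Arguments.
Unset Strict Implicit.
Unset Printing Implicit Defensive.

Import Order.TTheory GRing.Theory Num.Theory.
Import numFieldTopology.Exports numFieldNormedType.Exports.

Local Open Scope classical_set_scope.
Local Open Scope ring_scope.

(* Elements of V need not be vertices: [fset v] may fail to be a simplex. *)
Record simplicial_complex (V : choiceType) := SimplicialComplex {
  simplex : set {fset V};
  simplex_neq0 : forall s, simplex s -> s != fset0;
  simplex_sub : forall s t : {fset V},
    simplex s -> t != fset0 -> (t `<=` s)%fset -> simplex t
}.

Section Dowker.
Variables (A X : choiceType) (r : set (A * X)).

Definition dowkerA_simplex : set {fset A} :=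
  [set s | s != fset0 /\ exists x : X, [set` s] `*` [set x] `<=` r].

Definition dowkerX_simplex : set {fset X} :=
  [set s | s != fset0 /\ exists a : A, [set a] `*` [set` s] `<=` r].

Lemma dowkerA_neq0 s : dowkerA_simplex s -> s != fset0.
Proof. by case. Qed.

Lemma dowkerA_sub (s t : {fset A}) : dowkerA_simplex s ->
  t != fset0 -> (t `<=` s)%fset -> dowkerA_simplex t.
Proof.
move=> [_ [x sx]] t0 /fsubsetP ts; split => //; exists x => -[a y] [/= ta yx].
by apply: sx; split => //=; exact: ts.
Qed.

Lemma dowkerX_neq0 s : dowkerX_simplex s -> s != fset0.
Proof. by case. Qed.

Lemma dowkerX_sub (s t : {fset X}) : dowkerX_simplex s ->
  t != fset0 -> (t `<=` s)%fset -> dowkerX_simplex t.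
Proof.
move=> [_ [a sa]] t0 /fsubsetP ts; split => //; exists a => -[b x] [/= ba tx].
by apply: sa; split => //=; exact: ts.
Qed.

Definition dowkerA := SimplicialComplex dowkerA_neq0 dowkerA_sub.
Definition dowkerX := SimplicialComplex dowkerX_neq0 dowkerX_sub.

End Dowker.

(* Points are given by their barycentric coordinates. *)
Record realization (R : realType) (V : choiceType) (K : simplicial_complex V) :=
  RealizationPoint {
    bary :> {fsfun V -> R with 0};
    bary_simplex : simplex K (finsupp bary);
    bary_ge0 : forall v, 0 <= bary v;
    bary_sum1 : \sum_(v <- finsupp bary) bary v = 1
  }.

Section RealizationTopology.
Variables (R : realType) (V : choiceType) (K : simplicial_complex V).
Local Notation "|K|" := (realization R K).

Definition closed_cell (s : {fset V}) : set |K| :=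
  [set p | (finsupp p `<=` s)%fset].

(* The weak (coherent) topology: U is open iff its trace on every closed cell
   |s| is open in |s|, seen as a subspace of the Euclidean space R^s. *)
Definition realization_open : set_system |K| :=
  [set U | forall s, simplex K s -> exists2 W : set {ptws s -> R},
     open W & U `&` closed_cell s =
              [set p : |K| | W (fun v : s => p (val v))] `&` closed_cell s].

Lemma realization_openT : realization_open setT.
Proof. by move=> s _; exists setT; [exact: openT|]. Qed.

Lemma realization_openI : setI_closed realization_open.
Proof.
move=> U1 U2 o1 o2 s Ks.
have [W1 oW1 e1] := o1 s Ks; have [W2 oW2 e2] := o2 s Ks.
exists (W1 `&` W2); first exact: openI.
by rewrite -[closed_cell s]setIid setIACA e1 e2 setIACA.
Qed.

Lemma realization_open_bigU (I : Type) (U : I -> set |K|) :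
  (forall i, realization_open (U i)) -> realization_open (\bigcup_i U i).
Proof.
move=> oU s Ks.
have /choice[W WP] i : exists W : set {ptws s -> R}, open W /\
    U i `&` closed_cell s =
      [set p : |K| | W (fun v : s => p (val v))] `&` closed_cell s.
  by have [W ? ?] := oU i s Ks; exists W.
exists (\bigcup_i W i); first by apply: bigcup_open => i _; exact: (WP i).1.
rewrite setI_bigcupl [X in _ = X `&` _](_ : _ =
  \bigcup_i [set p : |K| | W i (fun v : s => p (val v))])//.
by rewrite setI_bigcupl; apply: eq_bigcupr => i _; exact: (WP i).2.
Qed.

HB.instance Definition _ := gen_eqMixin |K|.
HB.instance Definition _ := gen_choiceMixin |K|.
HB.instance Definition _ := isOpenTopological.Build |K|
  realization_openT realization_openI realization_open_bigU.

End RealizationTopology.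

Section Homotopy.
Variable R : realType.

Definition homotopic (S T : topologicalType) (f g : S -> T) :=
  exists H : S * R -> T,
    [/\ {within [set: S] `*` `[0, 1], continuous H},
        forall p, H (p, 0) = f p & forall p, H (p, 1) = g p].

Definition homotopy_equivalent (S T : topologicalType) :=
  exists (f : S -> T) (g : T -> S),
    [/\ continuous f, continuous g,
        homotopic (g \o f) idfun & homotopic (f \o g) idfun].

End Homotopy.

(* Main.v *)
(* For p in |D_A| and x in X let score(p, x) be the maximum of the barycentric
   coordinates p(a) over all a minus their maximum over the a not related to x;
   it is nonzero exactly when x is related to every a at which p peaks. So the x
   of nonzero score form a simplex of D_X, and normalizing the scores gives
   f : |D_A| -> |D_X|; exchanging A and X gives g : |D_X| -> |D_A|. The
   coordinates of f(p) are largest at those x that are related to the whole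
   support of p, and strictly smaller at every other x. Hence the support of
   g(f(p)) contains that of p, and the segment from g(f(p)) to p stays in a
   closed simplex, which gives the homotopy from g o f to the identity.

   Finiteness of the relation makes both complexes locally finite, so that near
   a point all supports lie in one fixed finite set; convergence in the weak
   topology is then convergence of each coordinate. *)
Require Import Defs.
From mathcomp Require Import all_boot all_order all_algebra finmap.
From mathcomp Require Import all_classical all_reals all_analysis.

Set Implicit Arguments.
Unset Strict Implicit.
Unset Printing Implicit Defensive.

Import Order.TTheory GRing.Theory Num.Theory.
Import numFieldTopology.Exports numFieldNormedType.Exports.

Local Open Scope classical_set_scope.
Local Open Scope ring_scope.

(** * Limits in product spaces and limits of finite maxima *)

Lemma cvg_ptws (U : eqType) (V : topologicalType) (T : Type)
    (F : set_system T) (FF : Filter F) (f : T -> U -> V) (g : U -> V) :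
  (forall u, f t u @[t --> F] --> g u) -> f @ F --> (g : {ptws U -> V}).
Proof.
move=> fg; apply/cvg_sup => u.
(* Constant functions show that evaluation at [u] is surjective. *)
rewrite cvg_image; last by rewrite eqEsubset; split=> v // _; exists (cst v).
move=> W /= /fg FW; exists (@^~ u @^-1` W) => //.
by rewrite eqEsubset; split => [v [h + <-//]|v Wv]; exists (cst v).
Qed.

Lemma cvg_bigmax (R : realType) (T I : Type) (F : set_system T)
    (FF : Filter F) (x : R) (s : seq I) (P : pred I) (f : I -> T -> R)
    (a : I -> R) :
  (forall i, f i @ F --> a i) ->
  \big[Num.max/x]_(i <- s | P i) f i t @[t --> F] -->
  \big[Num.max/x]_(i <- s | P i) a i.
Proof. by move=> fa; apply: cvg_big => //; exact: max_continuous. Qed.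

(** * The weak topology in barycentric coordinates *)

Section realization_topology.
Context (R : realType) (V : choiceType) (K : simplicial_complex V).
Local Notation "|K|" := (realization R K).

Lemma realization_eq (p q : |K|) : p =1 q -> p = q.
Proof.
case: p q => [p Kp p0 p1] [q Kq q0 q1] /= pq.
have {}pq : p = q by apply/fsfunP => v; exact: pq.
move: Kp p0 p1; rewrite pq => Kp p0 p1.
by congr RealizationPoint; exact: Prop_irrelevance.
Qed.

Lemma realization_gt0 (p : |K|) v : (v \in finsupp p) = (0 < p v).
Proof. by rewrite mem_finsupp lt0r bary_ge0 andbT. Qed.

(** Only the finitely many subsets of [B] occur as supports, so membership in an open set can be
    checked for one support at a time, inside a single closed cell. *)
Lemma cvg_realization (T : Type) (F : set_system T) (FF : Filter F)
    (f : T -> |K|) (p : |K|) (B : {fset V}) :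
  (\forall t \near F, (finsupp (f t) `<=` B)%fset) ->
  (forall v, f t v @[t --> F] --> p v) -> f @ F --> p.
Proof.
move=> fB fp U; rewrite nbhsE => -[G [oG Gp] GU].
apply: (@filterS _ _ _ (f @^-1` G)); first by move=> t /GU.
have Os s : s \in fpowerset B -> F [set t | finsupp (f t) = s -> G (f t)].
  move=> _; have [Ks|nKs] := pselect (simplex K s); last first.
    by apply: nearW => t fts; case: nKs; rewrite -fts; exact: bary_simplex.
  have [W oW GW] := oG s Ks.
  (* If [p] has a positive coordinate outside [s], that coordinate of [f t] is eventually positive
     too, so [s] is eventually not the support. *)
  have [ps|/fsubsetPn[v vp vs]] := boolP (finsupp p `<=` s)%fset.
    have Wp : W (fun v : s => p (val v)).
      have : (G `&` closed_cell s) p by split.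
      by rewrite GW => -[].
      have Wf : F [set t | W (fun v : s => f t (val v))].
        exact: (cvg_ptws (f := fun t (v : s) => f t (val v)) FF
        (fun v => fp (val v)) (open_nbhs_nbhs (conj oW Wp))).
    apply: filterS Wf => t Wt fts.
    have : ([set q : |K| | W (fun v : s => q (val v))] `&` closed_cell s) (f t).
      by split => //; rewrite /closed_cell/= fts.
    by rewrite -GW => -[].
  rewrite realization_gt0 in vp.
  apply: filterS (cvgr_gt _ (fp v) _ vp) => t fv fts.
  by rewrite -fts realization_gt0 fv in vs.
apply: filterS2 fB (filter_bigI FF Os) => t tB tO.
by apply: (tO (finsupp (f t))); rewrite //= fpowersetE.
Qed.

(** On the closed cell of [s] the coordinate is a projection when [v] is in [s], and is constantly 0
    otherwise. *)
Lemma continuous_bary v : continuous (fun p : |K| => p v : R).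
Proof.
apply/continuousP => G oG.
change (realization_open ((fun p : |K| => p v : R) @^-1` G)) => s Ks.
have [vs|vs] := boolP (v \in s).
  exists [set w : {ptws s -> R} | G (w [` vs]%fset)] => //.
  by move: (G) oG; apply/continuousP => w; exact: (@proj_continuous s (fun=> R)).
have pv (p : |K|) : closed_cell s p -> p v = 0.
  move=> /fsubsetP ps; apply/eqP; rewrite -memNfinsupp.
  by apply: contraNN vs; exact: ps.
have [G0|G0] := pselect (G 0).
  exists setT; first exact: openT.
  by rewrite eqEsubset; split => p [_ sp]; split => //=; rewrite pv.
exists set0; first exact: open0.
by rewrite eqEsubset; split => p [/= + sp]; rewrite // pv.
Qed.

Lemma realization_point (h : V -> R) (B : {fset V}) :
  (forall v, 0 <= h v) -> (forall v, v \notin B -> h v = 0) ->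
  \sum_(v <- B) h v = 1 ->
  (forall s : {fset V}, s != fset0 -> (forall v, v \in s -> h v != 0) ->
    simplex K s) ->
  exists p : |K|, p =1 h.
Proof.
move=> h0 hB h1 Kh; pose p := [fsfun v in B => h v] : {fsfun V -> R with 0}.
have ph : p =1 h.
  by move=> v; rewrite /p fsfunE; case: ifPn => // /hB.
have pB : (finsupp p `<=` B)%fset by exact: finsupp_sub.
have p1 : \sum_(v <- finsupp p) p v = 1.
  rewrite (big_fset_incl _ pB) => [|v _].
    by rewrite (eq_bigr _ (fun v _ => ph v)).
  by rewrite memNfinsupp => /eqP.
have Kp : simplex K (finsupp p).
  apply: Kh => [|v]; last by rewrite mem_finsupp ph.
  apply: contra_eq_neq p1 => ->; rewrite big_nil eq_sym; exact: oner_neq0.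
have p0 v : 0 <= p v by rewrite ph.
by exists (RealizationPoint Kp p0 p1).
Qed.

Lemma bary_sum (p : |K|) (B : {fset V}) :
  (finsupp p `<=` B)%fset -> \sum_(v <- B) p v = 1.
Proof.
move=> pB; rewrite -(bary_sum1 p); apply/esym/(big_fset_incl _ pB) => v _.
by rewrite memNfinsupp => /eqP.
Qed.

(** Coordinates outside the support vanish and the maximum starts at 0. This lets a fixed [B]
    replace a support that moves with the point. *)
Lemma bigmax_finsupp (p : |K|) (P : pred V) (B : {fset V}) :
  (finsupp p `<=` B)%fset ->
  \big[Num.max/0]_(v <- B | P v) p v =
  \big[Num.max/0]_(v <- finsupp p | P v) p v.
Proof.
move=> /fsubsetP pB; apply/eqP; rewrite eq_le; apply/andP; split; last first.
  rewrite big_seq_cond; apply: bigmax_le => [|v /andP[/pB vB Pv]].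
    by rewrite bigmax_idl le_max lexx.
  exact: le_bigmax_seq.
apply: bigmax_le => [|v Pv]; first by rewrite bigmax_idl le_max lexx.
have [vp|] := boolP (v \in finsupp p); first exact: le_bigmax_seq.
by rewrite memNfinsupp => /eqP ->; rewrite bigmax_idl le_max lexx.
Qed.

End realization_topology.

(** * Local finiteness and straight-line homotopies *)

Definition locally_finite (V : choiceType) (K : simplicial_complex V) :=
  forall v, exists B : {fset V},
    forall s, simplex K s -> v \in s -> (s `<=` B)%fset.

Section locally_finite.
Context (R : realType) (V : choiceType) (K : simplicial_complex V).
Hypothesis lfK : locally_finite K.
Local Notation "|K|" := (realization R K).
Implicit Types p q : |K|.

(** A vertex [v] of the support of [p] stays in the supports of nearby points, and all simplices
    through [v] lie in one finite set. *)
Lemma near_finsupp_sub (p : |K|) :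
  exists B : {fset V}, \forall q \near p, (finsupp (bary q) `<=` B)%fset.
Proof.
have /fset0Pn[v] := simplex_neq0 (bary_simplex p); rewrite realization_gt0 => pv.
have [B sB] := lfK v; exists B.
apply: filterS (cvgr_gt _ (@continuous_bary R V K v p) _ pv) => q qv.
by apply: sB; [exact: bary_simplex|rewrite realization_gt0].
Qed.

Lemma homotopic_finsupp_sub (f : |K| -> |K|) : continuous f ->
  (forall p, (finsupp p `<=` finsupp (f p))%fset) -> homotopic R f idfun.
Proof.
(* Clamping time to [0, 1] makes the segment meaningful for every real [t], so [H] is continuous on
   the whole product. *)
move=> cf fsub; pose c (t : R) := Num.min (Num.max 0 t) 1.
have c0 t : 0 <= c t by rewrite /c le_min ler01 le_max lexx.
have c1 t : 0 <= 1 - c t by rewrite /c subr_ge0 ge_min lexx orbT.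
have out z v : v \notin finsupp (f z.1) ->
    (1 - c z.2) * f z.1 v + c z.2 * bary z.1 v = 0.
  move=> vf; have vz : v \notin finsupp z.1.
    by apply: contraNN vf; exact: (fsubsetP (fsub z.1)).
  move: vf vz; rewrite !memNfinsupp => /eqP-> /eqP->.
  by rewrite !mulr0 addr0.
have H_ex (z : |K| * R) :
    exists q : |K|, q =1 (fun v => (1 - c z.2) * f z.1 v + c z.2 * z.1 v).
  apply: (@realization_point _ _ _ _ (finsupp (f z.1))).
  - by move=> v; rewrite addr_ge0// mulr_ge0// bary_ge0.
  - exact: out.
  - rewrite big_split/= -!mulr_sumr !bary_sum//.
    by rewrite !mulr1 subrK.
  - move=> s s0 hs; apply: simplex_sub (bary_simplex (f z.1)) s0 _.
    by apply/fsubsetP => v /hs; apply: contraNT => /out ->.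
have [H HE] := choice H_ex.
exists H; split; last 2 first.
- move=> p; apply: realization_eq => v; rewrite HE /c/= maxxx min_l//.
  by rewrite subr0 mul1r mul0r addr0.
- move=> p; apply: realization_eq => v; rewrite HE /c/= max_r// minxx.
  by rewrite subrr mul1r mul0r add0r.
apply: continuous_subspaceT => -[p t].
have [B pB] := near_finsupp_sub (f p).
have fstp : z.1 @[z --> (p, t)] --> p by exact: cvg_fst.
have fp : f z.1 @[z --> (p, t)] --> f p by apply: cvg_comp fstp _; exact: cf.
have fB : \forall z \near (p, t), (finsupp (f z.1) `<=` B)%fset.
  exact: fp pB.
(* The support of [H z] lies in that of [f z.1], hence in [B] near [(p, t)]; coordinatewise limits
   then suffice. *)
apply: (@cvg_realization _ _ _ _ _ _ _ _ B).
  apply: filterS fB => z; apply: fsubset_trans; apply/fsubsetP => v.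
  by rewrite mem_finsupp HE; apply: contraNT => /out ->.
move=> v; rewrite HE; under eq_fun do rewrite HE.
have ct : c z.2 @[z --> (p, t)] --> c t.
  apply: (@cvg_comp _ _ _ snd c); first exact: cvg_snd.
  apply: continuous_min; last exact: cvg_cst.
  by apply: continuous_max; [exact: cvg_cst|exact: cvg_id].
apply: cvgD; apply: cvgM => //.
- by apply: cvgB => //; exact: cvg_cst.
- exact: (cvg_comp _ _ fp (@continuous_bary _ _ _ v (f p))).
- exact: (cvg_comp _ _ fstp (@continuous_bary _ _ _ v p)).
Qed.

End locally_finite.

(* [dowkerX r] is not convertible to [dowkerA] of the transposed relation; this
   characterization lets one construction serve both directions. *)
Definition is_dowker (V W : choiceType) (r : V -> W -> bool)
    (K : simplicial_complex V) :=
  forall s, simplex K s <-> s != fset0 /\ exists w, forall v, v \in s -> r v w.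

(** A simplex through [v] has a witness among the finitely many neighbours of [v], and its vertices
    are neighbours of that witness. *)
Lemma is_dowker_locally_finite (V W : choiceType) (r : V -> W -> bool)
    (nV : V -> {fset W}) (nW : W -> {fset V}) (K : simplicial_complex V) :
  (forall v w, r v w -> w \in nV v) -> (forall v w, r v w -> v \in nW w) ->
  is_dowker r K -> locally_finite K.
Proof.
move=> nVP nWP KE v; exists (\bigcup_(w <- nV v) nW w)%fset => s.
move=> /KE[_ [w rw]] vs; apply/fsubsetP => u us; apply/bigfcupP.
by exists w; [rewrite andbT; exact/nVP/rw|exact/nWP/rw].
Qed.

(** * The map given by normalized scores *)

Section dowker_map.
Context (R : realType) (V W : choiceType) (r : V -> W -> bool).
Variable nbr : V -> {fset W}.
Hypothesis nbrP : forall v w, r v w -> w \in nbr v.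
Context (K : simplicial_complex V) (L : simplicial_complex W).
Hypothesis KE : is_dowker r K.
Hypothesis LE : is_dowker (fun w v => r v w) L.
Local Notation "|K|" := (realization R K).
Local Notation "|L|" := (realization R L).
Implicit Types p q : |K|.

Definition peak p : R := \big[Num.max/0]_(v <- finsupp p) p v.

Definition score p w : R :=
  peak p - \big[Num.max/0]_(v <- finsupp p | ~~ r v w) p v.

(** A finite set containing every [w] of nonzero score, so that [mass] sums all scores. *)
Definition reach p : {fset W} := (\bigcup_(v <- finsupp p) nbr v)%fset.

Definition mass p : R := \sum_(w <- reach p) score p w.

Definition is_dowker_map (f : |K| -> |L|) :=
  forall p w, f p w = score p w / mass p.

Lemma bary_le_peak p v : p v <= peak p.
Proof.
have [vp|] := boolP (v \in finsupp p); first exact: le_bigmax_seq.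
by rewrite memNfinsupp => /eqP ->; rewrite /peak bigmax_idl le_max lexx.
Qed.

Lemma peak_gt0 p : 0 < peak p.
Proof.
have /fset0Pn[v] := simplex_neq0 (bary_simplex p); rewrite realization_gt0.
by move=> /lt_le_trans; apply; exact: bary_le_peak.
Qed.

Lemma score_ge0 p w : 0 <= score p w.
Proof.
rewrite subr_ge0; apply: bigmax_le => [|v _]; first exact/ltW/peak_gt0.
exact: bary_le_peak.
Qed.

Lemma score_le p v w : ~~ r v w -> score p w <= peak p - p v.
Proof.
move=> rvw; rewrite lerD2l lerN2.
have [vp|] := boolP (v \in finsupp p); first exact: le_bigmax_seq.
by rewrite memNfinsupp => /eqP ->; rewrite bigmax_idl le_max lexx.
Qed.

Lemma score_neq0_rel p v w : p v = peak p -> score p w != 0 -> r v w.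
Proof.
move=> pv; apply: contraNT => /(score_le p); rewrite pv subrr => s0.
by rewrite eq_le s0 score_ge0.
Qed.

Lemma peak_attained p : exists v, p v = peak p.
Proof.
apply: contrapT => /forallNP np; have := ltxx (peak p); rewrite {1}/peak.
rewrite bigmax_lt ?peak_gt0// => v _.
by rewrite lt_neqAle bary_le_peak andbT; exact/eqP/np.
Qed.

(** For a [w] witnessing that the support of [p] is a simplex, the subtracted maximum is empty,
    hence 0. *)
Lemma score_eq_peak p : exists w, score p w = peak p.
Proof.
have /KE[_ [w rw]] := bary_simplex p; exists w.
rewrite /score big_seq_cond big_pred0 ?subr0// => v.
by apply/negP => /andP[/rw ->].
Qed.

Lemma score_neq0_reach p w : score p w != 0 -> w \in reach p.
Proof.
have [v pv] := peak_attained p; move=> /(score_neq0_rel pv) rvw.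
apply/bigfcupP; exists v; last exact: nbrP.
by rewrite andbT realization_gt0 pv peak_gt0.
Qed.

Lemma mass_reachS p (B : {fset W}) : (reach p `<=` B)%fset ->
  mass p = \sum_(w <- B) score p w.
Proof.
move=> pB; apply: (big_fset_incl _ pB) => w _; apply: contraNeq.
exact: score_neq0_reach.
Qed.

Lemma mass_gt0 p : 0 < mass p.
Proof.
rewrite lt_neqAle eq_sym sumr_ge0 ?andbT => [|w _]; last exact: score_ge0.
have [w sw] := score_eq_peak p.
have sw0 : 0 < score p w by rewrite sw peak_gt0.
rewrite psumr_neq0 => [|? _]; last exact: score_ge0.
by apply/hasP; exists w => //=; apply: score_neq0_reach; rewrite gt_eqF.
Qed.

Lemma dowker_map_ex : exists f, is_dowker_map f.
Proof.
suff /choice[f fE] : forall p, exists q : |L|,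
    q =1 (fun w => score p w / mass p).
  by exists f.
move=> p; have m0 := mass_gt0 p; apply: (@realization_point _ _ _ _ (reach p)).
- by move=> w; rewrite divr_ge0 ?score_ge0 ?ltW.
- move=> w wp; rewrite (_ : score p w = 0) ?mul0r//.
  by apply/eqP; apply: contraNT wp; exact: score_neq0_reach.
- by rewrite -mulr_suml divff ?gt_eqF.
- move=> s s0 hs; apply/LE; split=> //.
  (* A vertex where [p] peaks is related to every [w] of nonzero score. *)
  have [v pv] := peak_attained p; exists v => w /hs.
  by rewrite mulf_eq0 negb_or => /andP[/(score_neq0_rel pv)].
Qed.

(** Near [p], scores are differences of maxima over a fixed [B], and masses are sums over a fixed
    [C], so [f] is continuous in each coordinate. *)
Lemma dowker_map_continuous (f : |K| -> |L|) :
  locally_finite K -> is_dowker_map f -> continuous f.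
Proof.
move=> lfK fE p; have [B pB] := near_finsupp_sub lfK p.
pose C := (\bigcup_(v <- B) nbr v)%fset.
have reachC q : (finsupp q `<=` B)%fset -> (reach q `<=` C)%fset.
  move=> /fsubsetP qB; apply/bigfcupsP => v /qB vB _.
  exact: (bigfcup_sup (P := xpredT) nbr vB).
apply: (@cvg_realization _ _ _ _ (nbhs p) _ _ _ C).
  apply: filterS pB => q /reachC /fsubsetP qC; apply/fsubsetP => w.
  rewrite mem_finsupp fE mulf_eq0 negb_or => /andP[sw _].
  exact/qC/score_neq0_reach.
pose sc q w := \big[Num.max/0]_(v <- B) q v -
  \big[Num.max/0]_(v <- B | ~~ r v w) (q v : R).
have scE q w : (finsupp q `<=` B)%fset -> score q w = sc q w.
  by move=> qB; rewrite /sc !(bigmax_finsupp _ qB).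
have fsc q w : (finsupp q `<=` B)%fset ->
    f q w = sc q w / \sum_(y <- C) sc q y.
  move=> qB; rewrite fE (mass_reachS (reachC _ qB)) scE//.
  by under eq_bigr do rewrite scE//.
have max_cvg (P : pred V) :
    \big[Num.max/0]_(v <- B | P v) (q v : R) @[q --> p] -->
    \big[Num.max/0]_(v <- B | P v) (p v : R).
  apply: (@cvg_bigmax _ _ _ (nbhs p) _ _ _ _ (fun v q => bary q v)) => v.
  exact: continuous_bary.
have sc_cvg w : sc q w @[q --> p] --> sc p w.
  exact: (cvgB (F := nbhs p) (max_cvg xpredT) (max_cvg _)).
move=> w; rewrite fsc; last exact: nbhs_singleton pB.
have : sc q w / \sum_(y <- C) sc q y @[q --> p] -->
       sc p w / \sum_(y <- C) sc p y.
  apply: (cvgM (F := nbhs p)) => //; apply: (cvgV (F := nbhs p)).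
    (* Inversion is continuous here because the limit of the denominators is the positive
       [mass p]. *)
    rewrite (_ : \sum_(y <- C) sc p y = mass p) ?gt_eqF ?mass_gt0//.
    have pB' := nbhs_singleton pB.
    rewrite (mass_reachS (reachC _ pB')).
    by under [RHS]eq_bigr do rewrite scE//.
  by apply: (@cvg_big _ _ _ _ _ _ _ (nbhs p)) => // -[a b]; exact: add_continuous.
apply: cvg_trans; apply: near_eq_cvg; apply: filterS pB => q qB.
by rewrite fsc.
Qed.

End dowker_map.

(** * The composites and the homotopy equivalence *)

Lemma finsupp_dowker_mapK (R : realType) (V W : choiceType) (r : V -> W -> bool)
    (nV : V -> {fset W}) (nW : W -> {fset V})
    (K : simplicial_complex V) (L : simplicial_complex W)
    (f : realization R K -> realization R L)
    (g : realization R L -> realization R K) :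
  (forall v w, r v w -> w \in nV v) -> (forall v w, r v w -> v \in nW w) ->
  is_dowker r K -> is_dowker (fun w v => r v w) L ->
  is_dowker_map r nV f -> is_dowker_map (fun w v => r v w) nW g ->
  forall p : realization R K, (finsupp p `<=` finsupp (g (f p)))%fset.
Proof.
move=> nVP nWP KE LE fE gE p; apply/fsubsetP => v vp.
have m0 := mass_gt0 nVP KE p; have m0' := mass_gt0 (fun w v => nWP v w) LE (f p).
rewrite mem_finsupp gE mulf_neq0 ?invr_eq0 ?gt_eqF// subr_gt0.
have [w0 sw0] := score_eq_peak KE p.
(* Each [w] unrelated to [v] has score at most [peak p - p v], strictly below the score [peak p] of
   [w0]; so [v] gets a positive score from [f p]. *)
apply: bigmax_lt => [|w rvw]; first exact: peak_gt0.
apply: (@lt_le_trans _ _ (f p w0)); last exact: bary_le_peak.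
rewrite !fE ltr_pM2r ?invr_gt0// sw0.
apply: le_lt_trans (score_le p rvw) _.
by rewrite ltrBlDr ltrDl -realization_gt0.
Qed.

Lemma homotopic_dowker_mapK (R : realType) (V W : choiceType)
    (r : V -> W -> bool) (nV : V -> {fset W}) (nW : W -> {fset V})
    (K : simplicial_complex V) (L : simplicial_complex W)
    (f : realization R K -> realization R L)
    (g : realization R L -> realization R K) :
  (forall v w, r v w -> w \in nV v) -> (forall v w, r v w -> v \in nW w) ->
  is_dowker r K -> is_dowker (fun w v => r v w) L ->
  is_dowker_map r nV f -> is_dowker_map (fun w v => r v w) nW g ->
  homotopic R (g \o f) idfun.
Proof.
move=> nVP nWP KE LE fE gE; have lfK := is_dowker_locally_finite nVP nWP KE.
have lfL := is_dowker_locally_finite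
  (fun w v => nWP v w) (fun w v => nVP v w) LE.
apply: homotopic_finsupp_sub => //; last exact: finsupp_dowker_mapK LE fE gE.
move=> p; apply: continuous_comp.
  exact: (dowker_map_continuous nVP KE lfK fE).
exact: (dowker_map_continuous (fun w v => nWP v w) LE lfL gE).
Qed.

Theorem theorem3p6 (R : realType) (A X : choiceType) (r : set (A * X))
    (finA : forall a : A, finite_set [set x | r (a, x)])
    (finX : forall x : X, finite_set [set a | r (a, x)]) :
  homotopy_equivalent R (realization R (dowkerA r)) (realization R (dowkerX r)).
Proof.
pose e a x := (a, x) \in r.
(* The finiteness hypotheses enter through these neighbour sets, since [fset_set] has the intended
   elements only for a finite set. *)
pose nA a := fset_set [set x | r (a, x)].
pose nX x := fset_set [set a | r (a, x)].
have nAP a x : e a x -> x \in nA a by rewrite in_fset_set// !inE.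
have nXP a x : e a x -> a \in nX x by rewrite in_fset_set// !inE.
have AE : is_dowker e (dowkerA r).
  move=> s; split=> -[s0 [x sx]]; split=> //; exists x.
    by move=> a sa; rewrite inE; apply: sx.
  by move=> [a y] [/= /sx + ->]; rewrite inE.
have XE : is_dowker (fun x a => e a x) (dowkerX r).
  move=> s; split=> -[s0 [a sa]]; split=> //; exists a.
    by move=> x sx; rewrite inE; apply: sa.
  by move=> [b x] [/= -> /sa]; rewrite inE.
have [f fE] := @dowker_map_ex R A X e nA nAP _ _ AE XE.
have [g gE] := @dowker_map_ex R X A _ nX (fun x a => nXP a x) _ _ XE AE.
have lfA := is_dowker_locally_finite nAP nXP AE.
have lfX := is_dowker_locally_finite
  (fun x a => nXP a x) (fun x a => nAP a x) XE.
exists f, g; split.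
- exact: (dowker_map_continuous nAP AE lfA fE).
- exact: (dowker_map_continuous (fun x a => nXP a x) XE lfX gE).
- exact: (homotopic_dowker_mapK nAP nXP AE XE fE gE).
- exact: (homotopic_dowker_mapK (fun x a => nXP a x) (fun x a => nAP a x)
    XE AE gE fE).
Qed.
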